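(* Let $d\in\{1,2,3\}$, $\Omega=(0,1)^d$, $V_0=H^1_0(\Omega)$, $f\in L^2(\Omega)$, and let $A_\epsilon, A_0\in L^\infty(\Omega,\mathbb{M}^{d\times d}_{\mathrm{sym}})$ satisfy, for all $\zeta\in\mathbb{R}^d$ and (almost) all $x\in\Omega$, $$\lambda^\epsilon_\ominus|\zeta|^2\le A_\epsilon(x)\zeta\cdot\zeta\le\lambda^\epsilon_\oplus|\zeta|^2,\qquad \lambda^0_\ominus|\zeta|^2\le A_0(x)\zeta\cdot\zeta\le\lambda^0_\oplus|\zeta|^2$$ with positive constants $\lambda^\epsilon_\ominus,\lambda^\epsilon_\oplus,\lambda^0_\ominus,\lambda^0_\oplus$. Let $\lambda_1>0$ and $c_\oplus>0$ be constants such that for all $\zeta\in\mathbb{R}^d$ and (almost) all $x\in\Omega$ $$\lambda_1A_0\zeta\cdot\zeta\le A_\epsilon\zeta\cdot\zeta,\qquad A_\epsilon A_0^{-1}A_\epsilon\zeta\cdot\zeta\le c_\oplus A_0\zeta\cdot\zeta .$$ Put $\rho_*=\lambda_1/c_\oplus$ and $q(\rho)=\sqrt{1-2\rho\lambda_1+\rho^2c_\oplus}$. Let $u_\epsilon\in V_0$ be the solution of $a_\epsilon(u_\epsilon,w)=(f,w)_\Omega$ for all $w\in V_0$. Then for any $u_0\in V_0$ and any $\rho\in(0,2\rho_* )$, the sequence $\{u_k\}\subset V_0$ defined by $$a_0(u_{k+1},w)=a_0(u_k,w)-\rho\,\big(a_\epsilon(u_k,w)-(f,w)_\Omega\big)\qquad\forall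 w\in V_0,\quad k=0,1,2,\dots$$ converges to $u_\epsilon$ in $H^1(\Omega)$ as $k\to+\infty$, and $$\|u_k-u_\epsilon\|_0\le q^k(\rho)\,\|u_0-u_\epsilon\|_0 \qquad\text{for all } k.$$
   Context: $\mathbb{M}^{d\times d}_{\mathrm{sym}}$ denotes the set of real symmetric $d\times d$ matrices. Notation: $a_\epsilon(u,w)=\int_\Omega A_\epsilon\nabla u\cdot\nabla w\,dx$, $a_0(u,w)=\int_\Omega A_0\nabla u\cdot\nabla w\,dx$, $(f,w)_\Omega=\int_\Omega fw\,dx$, and $\|w\|_0=a_0(w,w)^{1/2}$ (the energy norm of $A_0$ on $V_0$, not the $L^2$ norm). *)

(* Defs.v *)
From HB Require Import structures.
From mathcomp Require Import all_boot all_order all_algebra.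
From mathcomp Require Import all_classical all_reals all_analysis.

Set Implicit Arguments.
Unset Strict Implicit.
Unset Printing Implicit Defensive.

Import Order.TTheory GRing.Theory Num.Theory.
Import numFieldNormedType.Exports.

Local Open Scope classical_set_scope.
Local Open Scope ring_scope.

Definition cV_display : measure_display -> measure_display.
Proof. exact. Qed.

(* R^n with the sigma-algebra generated by the coordinates, i.e. the Borel
   sigma-algebra. *)
Section measurable_cV.
Context (R : realType) (n : nat).

Let coord (i : 'I_n) (x : 'cV[R]_n) : R := x i 0.

Let cV_set0 : g_sigma_preimage coord set0.
Proof. exact: sigma_algebra0. Qed.

Let cV_setC A : g_sigma_preimage coord A -> g_sigma_preimage coord (~` A).
Proof. exact: sigma_algebraC. Qed.

Let cV_bigcup (F : _^nat) : (forall i, g_sigma_preimage coord (F i)) ->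
  g_sigma_preimage coord (\bigcup_i (F i)).
Proof. exact: sigma_algebra_bigcup. Qed.

HB.instance Definition _ := @isMeasurable.Build
  (cV_display default_measure_display) 'cV[R]_n (g_sigma_preimage coord)
  cV_set0 cV_setC cV_bigcup.

Lemma measurable_coord (i : 'I_n) :
  measurable_fun [set: 'cV[R]_n] (fun x => x i 0).
Proof.
move=> _ Y mY; rewrite setTI; apply: sub_sigma_algebra => /=.
rewrite -bigcup_seq/=; exists i => /=; first by rewrite mem_index_enum.
by exists Y => //; rewrite setTI.
Qed.

Lemma measurable_fun_coordP d (T : measurableType d) (h : T -> 'cV[R]_n) :
  (forall i, measurable_fun [set: T] (fun t => h t i 0)) ->
  measurable_fun [set: T] h.
Proof.
move=> mh.
have hG : g_sigma_preimage coord `<=` [set A | measurable (h @^-1` A)].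
  apply: smallest_sub.
    split=> /=.
    - by rewrite preimage_set0.
    - by move=> A mA; rewrite setTD preimage_setC; exact: measurableC.
    - by move=> F mF; rewrite preimage_bigcup; exact: bigcupT_measurable.
  rewrite -bigcup_seq; apply: bigcup_sub => i _ A [B mB <-] /=.
  by rewrite setTI -comp_preimage -[X in measurable X]setTI; exact: mh.
by move=> _ A mA; rewrite setTI; exact: hG.
Qed.

Lemma measurable_box (A : 'I_n -> set R) : (forall i, measurable (A i)) ->
  measurable [set x : 'cV[R]_n | forall i, A i (x i 0)].
Proof.
move=> mA; rewrite (_ : [set x | _] =
    \bigcap_(i in [set: 'I_n]) (fun x : 'cV[R]_n => x i 0) @^-1` A i); last first.
  by apply/seteqP; split => x /= Ax i; [move=> _; exact: Ax | exact: Ax].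
apply: fin_bigcap_measurable => // i _.
by rewrite -[X in measurable X]setTI; apply: measurable_coord.
Qed.

End measurable_cV.

(* Canonical inference of sigma-finiteness on a product measure only finds the
   instance for subprobabilities. *)
Lemma product_sigma_finite d1 d2 (T1 : measurableType d1)
    (T2 : measurableType d2) (R : realType)
    (m1 : {sigma_finite_measure set T1 -> \bar R})
    (m2 : {sigma_finite_measure set T2 -> \bar R}) :
  sigma_finite setT (m1 \x m2)%E.
Proof.
have /sigma_finiteP[F [TF ndF Foo]] := sigma_finiteT m1.
have /sigma_finiteP[G [TG ndG Goo]] := sigma_finiteT m2.
exists (fun n => F n `*` G n).
  rewrite -setXTT TF TG predeqE => -[x y]; split.
    move=> [/= [n _ Fnx] [k _ Gky]]; exists (maxn n k) => //; split.
    - by move: x Fnx; exact/subsetPset/ndF/leq_maxl.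
    - by move: y Gky; exact/subsetPset/ndG/leq_maxr.
  by move=> [n _ []/= ? ?]; split; exists n.
move=> k; have [? ?] := Foo k; have [? ?] := Goo k.
split; first exact: measurableX.
by rewrite product_measure1E// lte_mul_pinfty// ge0_fin_numE.
Qed.

Section lebesgue_cV.
Context {R : realType}.

Definition cons_cV n (p : R * 'cV[R]_n) : 'cV[R]_n.+1 :=
  col_mx (p.1%:M : 'cV[R]_1) p.2.

Lemma cons_cV_head n (p : R * 'cV[R]_n) (j : 'I_1) :
  cons_cV p (lshift n j) 0 = p.1.
Proof.
by rewrite (ord1 j) /cons_cV; apply: etrans (col_mxEu _ _ _ _) _; rewrite mxE.
Qed.

Lemma cons_cV_behead n (p : R * 'cV[R]_n) (j : 'I_n) :
  cons_cV p (rshift 1 j) 0 = p.2 j 0.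
Proof. exact: col_mxEd. Qed.

Lemma measurable_cons_cV n :
  measurable_fun [set: R * 'cV[R]_n] (@cons_cV n).
Proof.
apply: measurable_fun_coordP => i.
case: (@splitP 1 n i) => j ij.
  have -> : i = lshift n j by exact/val_inj.
  by under eq_fun do rewrite cons_cV_head; exact: measurable_fst.
have -> : i = rshift 1 j by exact/val_inj.
under eq_fun do rewrite cons_cV_behead.
exact: measurableT_comp (measurable_coord _) measurable_snd.
Qed.

Definition uncons_cV n (x : 'cV[R]_n.+1) : R * 'cV[R]_n :=
  (x ord0 0, \col_i x (lift ord0 i) 0).

Lemma cons_cVK n : cancel (@cons_cV n) (@uncons_cV n).
Proof.
move=> [a v]; rewrite /uncons_cV; congr pair.
  have -> : ord0 = lshift n (ord0 : 'I_1) by exact/val_inj.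
  exact: (@cons_cV_head n (a, v)).
apply/colP => i; rewrite mxE.
have -> : lift ord0 i = rshift 1 i by exact/val_inj.
exact: (@cons_cV_behead n (a, v)).
Qed.

Lemma measurable_uncons_cV n :
  measurable_fun [set: 'cV[R]_n.+1] (@uncons_cV n).
Proof.
apply: measurable_fun_pair => /=; first exact: measurable_coord.
apply: measurable_fun_coordP => i.
by under eq_fun do rewrite mxE; exact: measurable_coord.
Qed.

Section step.
Variables (n : nat) (m : {sigma_finite_measure set 'cV[R]_n -> \bar R}).

Definition lebesgue_step : set 'cV[R]_n.+1 -> \bar R :=
  pushforward (@lebesgue_measure R \x m)%E (@cons_cV n).

Let lebesgue_step0 : lebesgue_step set0 = 0%E.
Proof. by rewrite /lebesgue_step /pushforward preimage_set0 measure0. Qed.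

Let lebesgue_step_ge0 A : (0 <= lebesgue_step A)%E.
Proof. by rewrite /lebesgue_step /pushforward; exact: measure_ge0. Qed.

Let lebesgue_step_sigma_additive : semi_sigma_additive lebesgue_step.
Proof.
move=> F mF tF mUF; rewrite /lebesgue_step /pushforward preimage_bigcup.
apply: measure_semi_sigma_additive.
- by move=> k; rewrite -[X in measurable X]setTI; exact: measurable_cons_cV.
- apply/trivIsetP => /= i j _ _ ij; rewrite -preimage_setI.
  by move/trivIsetP : tF => /(_ _ _ _ _ ij) ->//; rewrite preimage_set0.
- by rewrite -preimage_bigcup -[X in measurable X]setTI;
    exact: measurable_cons_cV.
Qed.

HB.instance Definition _ := isMeasure.Build _ _ _ lebesgue_step
  lebesgue_step0 lebesgue_step_ge0 lebesgue_step_sigma_additive.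

Let lebesgue_step_sigma_finite : sigma_finite setT lebesgue_step.
Proof.
have [F FT /all_and2[mF Foo]] :=
  product_sigma_finite (@lebesgue_measure R) m.
have muncons : measurable_fun [set: 'cV[R]_n.+1] (@uncons_cV n).
  exact: measurable_uncons_cV.
exists (fun k => @uncons_cV n @^-1` F k).
  by rewrite -preimage_bigcup -FT preimage_setT.
move=> k; split.
  rewrite -[X in measurable X]setTI.
  by apply: muncons; [exact: measurableT | exact: mF].
rewrite /lebesgue_step /pushforward -comp_preimage.
rewrite (_ : _ \o _ = id) ?preimage_id//.
by apply/funext => p; exact: cons_cVK.
Qed.

HB.instance Definition _ := Measure_isSigmaFinite.Build _ _ _ lebesgue_step
  lebesgue_step_sigma_finite.
End step.

(* n-dimensional Lebesgue measure, as an iterated product along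
   R x R^n = R^(n+1). *)
Fixpoint lebesgue_cV n : {sigma_finite_measure set 'cV[R]_n -> \bar R} :=
  if n is k.+1 then lebesgue_step (lebesgue_cV k) else dirac (0 : 'cV[R]_0).

Lemma lebesgue_cV_box n (A : 'I_n -> set R) :
  (forall i, measurable (A i)) ->
  (lebesgue_cV n [set x | forall i, A i (x i ord0)] =
   \prod_(i < n) lebesgue_measure (A i))%E.
Proof.
elim: n A => [|n IH] A mA.
  by rewrite big_ord0 /= diracE mem_set// => -[].
rewrite big_ord_recl -IH//= /lebesgue_step /pushforward.
rewrite -product_measure1E//=.
- congr ((_ \x _)%E _); apply/seteqP; split => -[a v] /=.
  + move=> Av; split=> [|i].
      have := Av ord0; rewrite (_ : ord0 = lshift n (ord0 : 'I_1)).
        by rewrite (@cons_cV_head n (a, v)).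
      exact/val_inj.
    have := Av (lift ord0 i); rewrite (_ : lift ord0 i = rshift 1 i).
      by rewrite (@cons_cV_behead n (a, v)).
    exact/val_inj.
  + move=> [Aa Av] i; case: (@splitP 1 n i) => j ij.
      have -> : i = lshift n j by exact/val_inj.
      rewrite (@cons_cV_head n (a, v)) (_ : lshift n j = ord0)//.
      by apply/val_inj => /=; rewrite (ord1 j).
    have -> : i = rshift 1 j by exact/val_inj.
    rewrite (@cons_cV_behead n (a, v)) (_ : rshift 1 j = lift ord0 j)//.
    exact/val_inj.
- exact: mA.
- exact: (@measurable_box _ _ (fun i => A (lift ord0 i))).
Qed.

End lebesgue_cV.

Section sobolev.
Context {R : realType} {d : nat}.
Local Notation E := 'cV[R]_d.

Definition unit_cube : set E := [set x | forall i, 0 < x i 0 < 1].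

Lemma measurable_unit_cube : measurable unit_cube.
Proof.
rewrite (_ : unit_cube = [set x | forall i, `]0, 1[%classic (x i 0)]).
  apply: (@measurable_box _ _ (fun=> `]0, 1[%classic)) => i.
  exact: measurable_itv.
by apply/seteqP; split => x /= cx i; have := cx i; rewrite in_itv.
Qed.

(* Lebesgue measure on the unit cube Omega, as a measure on R^d that vanishes
   outside Omega: integrals, L^p spaces and "almost everywhere" with respect to
   it are those of Omega. *)
Definition cube_measure : {measure set E -> \bar R} :=
  mrestr (lebesgue_cV d) measurable_unit_cube.

Definition dotv (x y : E) : R := \sum_i x i 0 * y i 0.

Definition L2ip (f g : E -> R) : R := \int[cube_measure]_x (f x * g x).

Definition Linfty_sym (A : E -> 'M[R]_d) : Prop :=
  (forall i j, (fun x => A x i j) \in Lfun cube_measure +oo%E) /\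
  {ae cube_measure, forall x, (A x)^T = A x}.

Definition partial (i : 'I_d) (phi : E -> R) : E -> R := 'D_(delta_mx i 0) phi.

(* C^oo: all iterated partial derivatives exist and are continuous. *)
Definition smooth (phi : E -> R) : Prop := forall s : seq 'I_d,
  let psi := foldr partial phi s in
  continuous psi /\ forall (x : E) (i : 'I_d), derivable psi x (delta_mx i 0).

Definition test_function : set (E -> R) := [set phi |
  [/\ smooth phi, compact (closure [set x | phi x != 0]) &
    closure [set x | phi x != 0] `<=` unit_cube]].

(* A function together with a candidate for its gradient.  The weak gradient of
   a function is unique almost everywhere, so an element of H^1 is represented
   by a pair made of the function and (a representative of) its weak gradient;
   the vector space structure is the componentwise one. *)
Definition jet : Type := ((E -> R) * (E -> E))%type.
HB.instance Definition _ := GRing.Zmodule.on jet.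

Definition grad (u : jet) : E -> E := u.2.

Definition jet_of (phi : E -> R) : jet :=
  (phi, fun x => \col_i partial i phi x).

Definition H1 : set jet := [set u |
  [/\ u.1 \in Lfun cube_measure 2%:E,
      forall i, (fun x => grad u x i 0) \in Lfun cube_measure 2%:E &
      forall phi i, test_function phi ->
        L2ip u.1 (partial i phi) = - L2ip (fun x => grad u x i 0) phi]].

Definition H1norm (u : jet) : R :=
  Num.sqrt (\int[cube_measure]_x (u.1 x ^+ 2 + dotv (grad u x) (grad u x))).

(* The closure of the test functions in H^1. *)
Definition H10 : set jet := [set u | H1 u /\
  forall e : R, 0 < e ->
    exists2 phi, test_function phi & H1norm (u - jet_of phi) < e].

Definition aform (A : E -> 'M[R]_d) (u w : jet) : R :=
  \int[cube_measure]_x dotv (A x *m grad u x) (grad w x).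

Definition energy_norm (A : E -> 'M[R]_d) (w : jet) : R :=
  Num.sqrt (aform A w w).

End sobolev.

Arguments unit_cube : clear implicits.
Arguments cube_measure : clear implicits.
Arguments H1 : clear implicits.
Arguments H10 : clear implicits.

(* Main.v *)
Require Import Defs.
From mathcomp Require Import all_boot all_order all_algebra.
From mathcomp Require Import all_classical all_reals all_analysis.
From mathcomp Require Import measurable_realfun ess_sup_inf ring lra.

Set Implicit Arguments.
Unset Strict Implicit.
Unset Printing Implicit Defensive.

Import Order.TTheory GRing.Theory Num.Theory.
Import numFieldNormedType.Exports.

Local Open Scope classical_set_scope.
Local Open Scope ring_scope.

(** The error [e_k = u_k - u_eps] satisfies
    [a_0(e_{k+1}, w) = a_0(e_k, w) - rho a_eps(e_k, w)].  Taking [w = e_{k+1}] and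
    writing the integrand on the right as the [A_0]-scalar product of
    [(1 - rho A_0^-1 A_eps) grad e_k] with [grad e_{k+1}], the pointwise AM-GM
    inequality gives [|e_{k+1}|_0^2 <= (q^2 |e_k|_0^2 + |e_{k+1}|_0^2) / 2],
    hence the contraction; and [q < 1] for [rho < 2 rho_*].  Convergence in [H^1]
    then needs the Poincare inequality on [H^1_0], obtained by testing the weak
    derivative of [u] against [x_i phi] with test functions [phi] tending to
    [u]. *)

(** * Arithmetic of [L^p] functions and monotonicity of the real-valued integral *)

Section Lfun_complements.
Context d (T : measurableType d) (R : realType).
Variable mu : {measure set T -> \bar R}.
Implicit Types f g : T -> R.

Lemma Lfun_measurable p f : f \in Lfun mu p -> measurable_fun setT f.
Proof. by rewrite inE => /andP[/[!inE]]. Qed.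

Lemma LfunB p f g : (1 <= p)%E ->
  f \in Lfun mu p -> g \in Lfun mu p -> (fun x => f x - g x) \in Lfun mu p.
Proof.
move=> p1 Lf Lg; have [_ LD] := Lfun_addr_closed mu p1.
have := LD f (- g) Lf (Lfun_oppr_closed Lg).
by rewrite fctE.
Qed.

Lemma LfunD p f g : (1 <= p)%E ->
  f \in Lfun mu p -> g \in Lfun mu p -> (fun x => f x + g x) \in Lfun mu p.
Proof.
move=> p1 Lf Lg; have [_ LD] := Lfun_addr_closed mu p1.
by have := LD f g Lf Lg; rewrite fctE.
Qed.

Lemma LfunZ p f (a : R) : (1 <= p)%E ->
  f \in Lfun mu p -> (fun x => a * f x) \in Lfun mu p.
Proof.
move=> p1 Lf; have [L0 LZ] := Lfun_submod_closed mu p1.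
by have := LZ a f 0 Lf L0; rewrite addr0 fctE.
Qed.

Lemma Lfun_sum p (I : Type) (s : seq I) (F : I -> T -> R) : (1 <= p)%E ->
  (forall i, F i \in Lfun mu p) -> (fun x => \sum_(i <- s) F i x) \in Lfun mu p.
Proof.
move=> p1 LF; have [L0 _] := Lfun_submod_closed mu p1.
elim: s => [|i s IH]; first by under eq_fun do rewrite big_nil.
by under eq_fun do rewrite big_cons; exact: LfunD.
Qed.

Lemma Lfun2P f : measurable_fun setT f ->
  mu.-integrable setT (fun x => (f x ^+ 2)%:E) -> f \in Lfun mu 2%:E.
Proof.
move=> mf /integrableP[_ fi]; rewrite inE; apply/andP; rewrite !inE; split=> //=.
rewrite /finite_norm unlock poweR_lty//.
under eq_integral => x _ do rewrite /= powR_mulrn// real_normK ?num_real//.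
by under eq_integral => x _ do rewrite -[_%:E]gee0_abs ?lee_fin ?sqr_ge0//.
Qed.

Lemma Lfun2_mul f g : f \in Lfun mu 2%:E -> g \in Lfun mu 2%:E ->
  (fun x => f x * g x) \in Lfun mu 1.
Proof. exact: Lfun2_mul_Lfun1. Qed.

Lemma Lfun2_sqr f : f \in Lfun mu 2%:E -> (fun x => f x ^+ 2) \in Lfun mu 1.
Proof. by move=> /Lfun2_integrable_sqr/Lfun1_integrable. Qed.

(** The square of the product is dominated almost everywhere by the integrable [M^2 g^2]. *)
Lemma Lfun2_ae_bounded_mul (M : R) f g : measurable_fun setT f ->
  {ae mu, forall x, `|f x| <= M} -> g \in Lfun mu 2%:E ->
  (fun x => f x * g x) \in Lfun mu 2%:E.
Proof.
move=> mf fM Lg; have mg := Lfun_measurable Lg.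
have mfg : measurable_fun setT (fun x => f x * g x) by exact: measurable_funM.
have mnX (h : T -> R) : measurable_fun setT h ->
    measurable_fun setT (fun x => `|h x ^+ 2|).
  by move=> mh; apply: measurableT_comp => //; exact: measurable_funX.
apply: Lfun2P => //; have /integrableP[_ g2] := Lfun2_integrable_sqr Lg.
apply/integrableP; split.
  by apply/measurable_EFinP; exact: measurable_funX.
apply: (@le_lt_trans _ _ (\int[mu]_x ((M ^+ 2)%:E * `|(g x ^+ 2)%:E|))%E); last first.
  rewrite ge0_integralZl//=.
  - by rewrite lte_mul_pinfty// lee_fin sqr_ge0.
  - by apply/measurable_EFinP; exact: mnX.
  - by rewrite lee_fin sqr_ge0.
apply: ae_ge0_le_integral => //.
- by apply/measurable_EFinP; exact: mnX.
- by move=> x _; rewrite -EFinM lee_fin mulr_ge0// sqr_ge0.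
- by apply/measurable_EFinP => /=; apply: measurable_funM => //; exact: mnX.
- apply: filterS fM => x fxM _ /=.
  rewrite -EFinM lee_fin exprMn normrM ler_wpM2r// normrX ler_sqr ?nnegrE//.
  exact: le_trans fxM.
Qed.

Lemma Lfuny_mul f g : f \in Lfun mu +oo%E -> g \in Lfun mu 2%:E ->
  (fun x => f x * g x) \in Lfun mu 2%:E.
Proof.
move=> Lf Lg; have := Lf; rewrite inE => /andP[_]; rewrite inE/= /finite_norm.
rewrite unlock /=; case: ifPn => [mu0 /ess_supr_bounded[M fM]|].
  exact: Lfun2_ae_bounded_mul (Lfun_measurable Lf) fM Lg.
(* The [L^oo] norm is 0 by convention on a space of measure zero; there every bound holds almost
   everywhere, in particular 0. *)
rewrite -leNgt => mu0 _; apply: (@Lfun2_ae_bounded_mul 0) => //.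
  exact: Lfun_measurable Lf.
by exists setT; split=> //; apply/eqP; rewrite eq_le mu0/=.
Qed.

Lemma Rint1D f g : f \in Lfun mu 1 -> g \in Lfun mu 1 ->
  \int[mu]_x (f x + g x) = \int[mu]_x f x + \int[mu]_x g x.
Proof. by move=> /Lfun1_integrable ? /Lfun1_integrable ?; exact: RintegralD. Qed.

Lemma Rint1B f g : f \in Lfun mu 1 -> g \in Lfun mu 1 ->
  \int[mu]_x (f x - g x) = \int[mu]_x f x - \int[mu]_x g x.
Proof. by move=> /Lfun1_integrable ? /Lfun1_integrable ?; exact: RintegralB. Qed.

Lemma Rint1Z f (a : R) : f \in Lfun mu 1 ->
  \int[mu]_x (a * f x) = a * \int[mu]_x f x.
Proof. by move=> /Lfun1_integrable ?; exact: RintegralZl. Qed.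

Lemma ae_le_Rint1 f g : f \in Lfun mu 1 -> g \in Lfun mu 1 ->
  {ae mu, forall x, f x <= g x} -> \int[mu]_x f x <= \int[mu]_x g x.
Proof.
move=> Lf Lg fg; have Lgf : (fun x => g x - f x) \in Lfun mu 1 by exact: LfunB.
rewrite -subr_ge0 -Rint1B//.
(* The sign of [g - f] is known only almost everywhere; the absolute value is nonnegative at every
   point and has the same integral. *)
have -> : \int[mu]_x (g x - f x) = \int[mu]_x `|g x - f x|.
  rewrite /Rintegral; congr fine; apply: ae_eq_integral => //.
  - by apply/measurable_EFinP; exact: Lfun_measurable Lgf.
  - by apply/measurable_EFinP/measurableT_comp => //; exact: Lfun_measurable Lgf.
  - by apply: filterS fg => x fgx _; rewrite ger0_norm// subr_ge0.
by apply: Rintegral_ge0 => x _.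
Qed.

End Lfun_complements.

(** * Euclidean scalar product and the pointwise contraction estimate *)

Section dotv_theory.
Context {R : realType} {d : nat}.
Local Notation E := 'cV[R]_d.
Implicit Types (x y z : E) (A : 'M[R]_d).

Lemma dotvE x y : dotv x y = (x^T *m y) 0 0.
Proof. by rewrite mxE; apply: eq_bigr => i _; rewrite mxE. Qed.

Lemma dotvC x y : dotv x y = dotv y x.
Proof. by apply: eq_bigr => i _; rewrite mulrC. Qed.

Lemma dotvDl x y z : dotv (x + y) z = dotv x z + dotv y z.
Proof. by rewrite -big_split; apply: eq_bigr => i _; rewrite mxE mulrDl. Qed.

Lemma dotvZl (a : R) x y : dotv (a *: x) y = a * dotv x y.
Proof. by rewrite mulr_sumr; apply: eq_bigr => i _; rewrite mxE mulrA. Qed.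

Lemma dotvBl x y z : dotv (x - y) z = dotv x z - dotv y z.
Proof. by rewrite -scaleN1r dotvDl dotvZl mulN1r. Qed.

Lemma dotvBr x y z : dotv x (y - z) = dotv x y - dotv x z.
Proof. by rewrite ![dotv x _]dotvC dotvBl. Qed.

Lemma dotvZr (a : R) x y : dotv x (a *: y) = a * dotv x y.
Proof. by rewrite ![dotv x _]dotvC dotvZl. Qed.

Lemma dotv_ge0 x : 0 <= dotv x x.
Proof. by apply: sumr_ge0 => i _; rewrite -expr2 sqr_ge0. Qed.

Lemma dotv_eq0 x : dotv x x <= 0 -> x = 0.
Proof.
move=> x0; apply/colP => i; rewrite mxE; apply/eqP.
have /eqP : dotv x x = 0 by apply/eqP; rewrite eq_le x0 dotv_ge0.
rewrite psumr_eq0 => [/allP/(_ i)|j _]; last by rewrite -expr2 sqr_ge0.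
by rewrite mem_index_enum mulf_eq0 orbb; apply.
Qed.

Lemma sqr_coord_le_dotv x (i : 'I_d) : x i 0 ^+ 2 <= dotv x x.
Proof.
rewrite /dotv (bigD1 i)//= -expr2 lerDl.
by apply: sumr_ge0 => j _; rewrite -expr2 sqr_ge0.
Qed.

Lemma dotv_mulmx_sym A x y : A^T = A -> dotv (A *m x) y = dotv (A *m y) x.
Proof.
by move=> sA; rewrite [RHS]dotvC !dotvE trmx_mul sA mulmxA.
Qed.

(** If [A z = 0] then [m |z|^2 <= 0], so the kernel is trivial. The transpose enters because [kermx]
    is the left kernel. *)
Lemma coercive_unitmx A (m : R) : 0 < m ->
  (forall z, m * dotv z z <= dotv (A *m z) z) -> A \in unitmx.
Proof.
move=> m0 Am; rewrite -unitmx_tr -row_free_unit -kermx_eq0.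
apply/rowV0P => v /sub_kermxP vA.
have Av0 : A *m v^T = 0 by rewrite -[A]trmxK -trmx_mul vA trmx0.
have := Am v^T; rewrite Av0.
have -> : dotv 0 v^T = 0 :> R by rewrite /dotv big1// => i _; rewrite mxE mul0r.
rewrite pmulr_rle0// => /dotv_eq0 v0.
by rewrite -[v]trmxK v0 trmx0.
Qed.

(* With p = g - r A^-1 B g, the left-hand side is A p . h, and AM-GM for the
   scalar product of A reduces the claim to an expansion of A p . p. *)
Lemma richardson_step_le A B (m lam c r q2 : R) (g h : E) :
  A^T = A -> B^T = B -> 0 < m -> (forall z, m * dotv z z <= dotv (A *m z) z) ->
  lam * dotv (A *m g) g <= dotv (B *m g) g ->
  dotv (B *m invmx A *m B *m g) g <= c * dotv (A *m g) g ->
  0 <= r -> 1 - 2 * r * lam + r ^+ 2 * c <= q2 ->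
  dotv (A *m g) h - r * dotv (B *m g) h
    <= 2^-1 * (q2 * dotv (A *m g) g) + 2^-1 * dotv (A *m h) h.
Proof.
move=> sA sB m0 Am lamB Bc r0 hq.
have uA := coercive_unitmx m0 Am.
have A0 z : 0 <= dotv (A *m z) z.
  by rewrite (le_trans _ (Am z))// mulr_ge0 ?dotv_ge0// ltW.
set b := B *m g; set s := invmx A *m b.
have As : A *m s = b by rewrite /s mulmxA mulmxV ?mul1mx.
have bs : dotv b s = dotv (B *m invmx A *m B *m g) g.
  by rewrite dotv_mulmx_sym// -!mulmxA.
have Asg : dotv (A *m g) s = dotv b g by rewrite dotv_mulmx_sym// As.
set p := g - r *: s.
have Ap : A *m p = A *m g - r *: b by rewrite mulmxBr -scalemxAr As.
have -> : dotv (A *m g) h - r * dotv b h = dotv (A *m p) h.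
  by rewrite Ap dotvBl dotvZl.
have App : dotv (A *m p) p =
    dotv (A *m g) g - 2 * r * dotv b g + r ^+ 2 * dotv b s.
  by rewrite Ap /p dotvBl !dotvBr !dotvZl !dotvZr Asg; ring.
(* The lower bound on [B] is scaled by [r >= 0] and the upper bound by [r^2]; together they leave
   the factor [1 - 2 r lam + r^2 c]. *)
have Apq : dotv (A *m p) p <= q2 * dotv (A *m g) g.
  rewrite App; have := ler_wpM2r (A0 g) hq; have := ler_wpM2l r0 lamB.
  have := ler_wpM2l (sqr_ge0 r) Bc; rewrite -bs -/b; lra.
clearbody p; have := A0 (p - h); rewrite mulmxBr dotvBl !dotvBr (dotv_mulmx_sym h p sA); lra.
Qed.

End dotv_theory.

(** * Square-integrable vector fields and the forms [a_eps], [a_0] *)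

Section energy_form.
Context {R : realType} {d : nat}.
Local Notation E := 'cV[R]_d.
Local Notation mu := (cube_measure R d).

Definition L2field (g : E -> E) : Prop :=
  forall i, (fun x => g x i 0) \in Lfun mu 2%:E.

Lemma L2field_mulmx (A : E -> 'M[R]_d) g : Linfty_sym A -> L2field g ->
  L2field (fun x => A x *m g x).
Proof.
move=> [Ab _] Lg i; under eq_fun do rewrite mxE.
by apply: Lfun_sum => [|j]; [exact: lee1n|exact: Lfuny_mul].
Qed.

Lemma L2field_dotv g h : L2field g -> L2field h ->
  (fun x => dotv (g x) (h x)) \in Lfun mu 1.
Proof. by move=> Lg Lh; apply: Lfun_sum => // i; exact: Lfun2_mul. Qed.

Lemma L2field_form (A : E -> 'M[R]_d) g h : Linfty_sym A ->
  L2field g -> L2field h -> (fun x => dotv (A x *m g x) (h x)) \in Lfun mu 1.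
Proof. by move=> bA Lg Lh; exact: L2field_dotv (L2field_mulmx bA Lg) Lh. Qed.

Lemma H1_L2field (u : @jet R d) : H1 R d u -> L2field (grad u).
Proof. by case. Qed.

Lemma aformBl (A : E -> 'M[R]_d) (u v w : jet) : Linfty_sym A ->
  L2field (grad u) -> L2field (grad v) -> L2field (grad w) ->
  aform A (u - v) w = aform A u w - aform A v w.
Proof.
move=> bA Lu Lv Lw; rewrite -Rint1B; [|exact: L2field_form..].
by congr Rintegral; apply/funext => x; rewrite mulmxBr dotvBl.
Qed.

End energy_form.

(** * Borel sets of [R^d] and finiteness of the measure of the cube *)

Section cube.
Context {R : realType} {d : nat}.
Local Notation E := 'cV[R]_d.
Local Notation mu := (cube_measure R d).

(* An open set is the union of the countably many cubes with rational centre and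
   radius 1/(k+1) that it contains. *)
Lemma open_measurable_cV (U : set E) : open U -> measurable U.
Proof.
pose box (p : 'cV[rat]_d * nat) : set E :=
  [set x | forall i, ball (ratr (p.1 i 0) : R) (p.2.+1%:R^-1) (x i 0)].
have mbox p : measurable (box p).
  have := @measurable_box R d (fun i => ball (ratr (p.1 i 0) : R) p.2.+1%:R^-1).
  by apply => i; exact: measurable_ball.
move=> oU; have -> : U = \bigcup_(p in [set p | box p `<=` U]) box p.
  apply/seteqP; split => [x Ux|x [p pU]]; last exact: pU.
  have := open_nbhs_nbhs (conj oU Ux); rewrite -nbhs_ballE => -[e /= e0 xU].
  (* A point of the box and [x] are both within [1/(k+1)] of the centre in each coordinate, hence
     within [e] of each other. *)
  have [k ke] : exists k, k.+1%:R^-1 < e / 2.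
    have := near_infty_natSinv_lt (PosNum (divr_gt0 e0 (ltr0n R 2))).
    by move=> [N _ /(_ N (leqnn N))]; exists N.
  have ratx i : exists q : rat, `|ratr q - x i 0| < k.+1%:R^-1.
    have /rat_in_itvoo[q] : x i 0 < x i 0 + k.+1%:R^-1 by rewrite ltrDl.
    rewrite in_itv/= => /andP[xq qx]; exists q.
    by rewrite gtr0_norm ?subr_gt0// ltrBlDl.
  have [q qx] := choice ratx.
  exists (\col_i q i, k); last by move=> i /=; rewrite mxE; exact: qx.
  move=> y yq; apply: xU; split => // i j; rewrite (ord1 j) [e]splitr.
  apply: (@ball_triangle _ _ (ratr (q i) : R)).
    by rewrite /ball/= distrC (lt_trans (qx i)).
  by have := yq i; rewrite /= mxE; apply: le_ball; exact: ltW.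
(* Boxes not contained in [U] are replaced by the empty set, so the union runs over a whole
   countable type. *)
rewrite bigcup_mkcond; apply: countable_bigcupT_measurable => // p.
by case: ifP.
Qed.

(** The sigma-algebra here is generated by coordinates, so the open preimages of open intervals are
    measurable thanks to [open_measurable_cV]. *)
Lemma continuous_measurable_cV (phi : E -> R) :
  continuous phi -> measurable_fun setT phi.
Proof.
move=> /continuousP cphi; apply: (measurability _ (RGenOpens.measurableE R)).
move=> _ [_ [a [b ->] <-]]; rewrite setTI; apply: open_measurable_cV.
exact/cphi/interval_open.
Qed.

Lemma cube_measure_fin : (mu setT < +oo)%E.
Proof.
rewrite /cube_measure/= /mrestr setTI.
have -> : unit_cube R d = [set x | forall i, `]0, 1[%classic (x i 0)].
  by apply/seteqP; split => x /= cx i; have := cx i; rewrite in_itv.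
rewrite (@lebesgue_cV_box _ _ (fun=> `]0, 1[%classic))//.
by rewrite big1 ?ltry// => i _; rewrite lebesgue_measure_itv/= lte01 oppr0 adde0.
Qed.

End cube.

(** * Differential calculus and supports of test functions *)

Section test_functions.
Context {R : realType} {d : nat}.
Local Notation E := 'cV[R]_d.
Local Notation mu := (cube_measure R d).
Implicit Types (phi psi : E -> R) (i j : 'I_d).

(** By linearity of the coordinate, the difference quotient is constant for nonzero steps. *)
Lemma is_derive_coord i (x v : E) : is_derive x v (fun y : E => y i 0) (v i 0).
Proof.
have cv : (fun h : R => h^-1 *: ((fun y : E => y i 0) \o shift x) (h *: v)
    - h^-1 *: x i 0) @ 0^' --> v i 0.
  apply: cvg_near_cst; near=> h.
  have h0 : h != 0 by near: h; exact: nbhs_dnbhs_neq.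
  by rewrite /= !mxE -scalerBr addrK scalerA mulVf// scale1r.
have {}cv : (fun h : R => h^-1 *: (((fun y : E => y i 0) \o shift x) (h *: v)
    - x i 0)) @ 0^' --> v i 0.
  by apply: cvg_trans cv; apply: near_eq_cvg; near=> h; rewrite scalerBr.
by apply: DeriveDef; [apply/cvg_ex; exists (v i 0)|exact: cvg_lim cv].
Unshelve. all: by end_near. Qed.

Lemma smooth_continuous phi : smooth phi -> continuous phi.
Proof. by move=> /(_ [::])[]. Qed.

Lemma smooth_derivable phi : smooth phi ->
  forall (x : E) i, derivable phi x (delta_mx i 0).
Proof. by move=> /(_ [::])[]. Qed.

(** A derivative taken first is an extra index at the end of the sequence in [smooth]. *)
Lemma smooth_partial i phi : smooth phi -> smooth (partial i phi).
Proof. by move=> sphi s; have := sphi (rcons s i); rewrite foldr_rcons. Qed.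

Lemma smooth_foldr_partial s phi : smooth phi -> smooth (foldr partial phi s).
Proof. by move=> sphi; elim: s => [|i s IH]; [exact: sphi|exact: smooth_partial IH]. Qed.

Lemma partialB i phi psi (x : E) : derivable phi x (delta_mx i 0) ->
  derivable psi x (delta_mx i 0) ->
  partial i (fun y => phi y - psi y) x = partial i phi x - partial i psi x.
Proof. exact: deriveB. Qed.

Lemma smoothB phi psi : smooth phi -> smooth psi ->
  smooth (fun x => phi x - psi x).
Proof.
move=> sphi spsi s.
have -> : foldr partial (fun x => phi x - psi x) s =
    (fun x => foldr partial phi s x - foldr partial psi s x).
  elim: s => //= i s ->; apply/funext => x.
  by rewrite partialB//; exact/smooth_derivable/smooth_foldr_partial.
split=> [x|x i].
  have cD f (sf : smooth f) :=
    @smooth_continuous _ (smooth_foldr_partial s sf) x.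
  exact: cvgB (cD _ sphi) (cD _ spsi).
by apply: derivableB; exact/smooth_derivable/smooth_foldr_partial.
Qed.

(** Serves [smooth_coordM], where the Leibniz rule leaves such sums to be differentiated again. *)
Lemma is_derive_sum_foldr_partial phi (l : seq (seq 'I_d)) j (x : E) :
  smooth phi -> is_derive x (delta_mx j 0)
    (fun y => \sum_(t <- l) foldr partial phi t y)
    (\sum_(t <- l) foldr partial phi (j :: t) x).
Proof.
move=> sphi; elim: l => [|t l IH].
  by rewrite big_nil; under eq_fun do rewrite big_nil; exact: is_derive_cst.
rewrite big_cons; under eq_fun do rewrite big_cons.
apply: is_deriveD IH; apply: DeriveDef => //.
exact/smooth_derivable/smooth_foldr_partial.
Qed.

Lemma is_derive_coordM phi i j (x : E) : smooth phi ->
  is_derive x (delta_mx j 0) (fun y => y i 0 * phi y)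
    (x i 0 * partial j phi x + (i == j)%:R * phi x).
Proof.
move=> sphi.
have dphi : is_derive x (delta_mx j 0) phi (partial j phi x).
  by apply: DeriveDef => //; exact: smooth_derivable.
have := is_deriveM (is_derive_coord i x (delta_mx j 0)) dphi.
by rewrite mxE eqxx andbT [X in _ + X]mulrC.
Qed.

(** By the Leibniz rule each iterated derivative [D^s] of [x_i phi] is [x_i D^s phi] plus a finite
    sum of iterated derivatives of [phi], a shape stable under differentiation. *)
Lemma smooth_coordM i phi : smooth phi -> smooth (fun x => x i 0 * phi x).
Proof.
move=> sphi s; have sD := fun t => smooth_foldr_partial t sphi.
have [l ->] : exists l : seq (seq 'I_d),
    foldr partial (fun x => x i 0 * phi x) s = (fun x =>
      x i 0 * foldr partial phi s x + \sum_(t <- l) foldr partial phi t x).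
  elim: s => [|j s [l IH]] /=.
    by exists [::]; apply/funext => x; rewrite big_nil addr0.
  (* [D_j x_i] is 1 or 0, so [D^s phi] joins the sum only when [i = j]; each old term gains the
     index [j]. *)
  exists ((if i == j then [:: s] else [::]) ++ map (cons j) l).
  apply/funext => x; rewrite big_cat big_map IH addrA.
  have dcoord := is_derive_coordM i j x (sD s).
  have dsum := is_derive_sum_foldr_partial l j x sphi.
  have dx := is_deriveD dcoord dsum.
  rewrite /partial (@derive_val _ _ _ _ _ _ _ dx); congr (_ + _ + _).
  by case: eqP => _; rewrite ?big_seq1 ?mul1r ?big_nil ?mul0r.
split=> [x|x j].
  apply: (cvgD (cvgM (@coord_continuous _ _ _ i 0 x)
    (@smooth_continuous _ (sD s) x))).
  elim: l => [|t l IH].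
    by under eq_fun do rewrite big_nil; rewrite big_nil; exact: cvg_cst.
  under eq_fun do rewrite big_cons; rewrite big_cons.
  exact: cvgD (@smooth_continuous _ (sD t) x) IH.
apply: derivableD; first by case: (is_derive_coordM i j x (sD s)).
by case: (is_derive_sum_foldr_partial l j x sphi).
Qed.

(** The support of [phi] is closed, so it contains that of [psi], which is then a closed subset of a
    compact set. *)
Lemma test_function_supp phi psi : test_function phi -> smooth psi ->
  [set x | psi x != 0] `<=` closure [set x | phi x != 0] -> test_function psi.
Proof.
move=> [_ cphi phiO] spsi psiphi.
have sub : closure [set x | psi x != 0] `<=` closure [set x | phi x != 0].
  move=> x /(closure_subset psiphi); rewrite -(closure_id _).1//.
  exact: closed_closure.
split=> //; last exact: subset_trans sub phiO.
by apply: subclosed_compact sub => //; exact: closed_closure.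
Qed.

Lemma test_functionB phi psi : test_function phi -> test_function psi ->
  test_function (fun x => phi x - psi x).
Proof.
move=> [sphi cphi phiO] [spsi cpsi psiO].
have sub : closure [set x | phi x - psi x != 0] `<=`
    closure [set x | phi x != 0] `|` closure [set x | psi x != 0].
  rewrite -closureU; apply: closure_subset => x /= xN0.
  by have [px0|] := eqVneq (phi x) 0; [right|left];
    move: xN0; rewrite ?px0 ?sub0r ?oppr_eq0.
split; first exact: smoothB.
  apply: subclosed_compact sub; first exact: closed_closure.
  exact: compactU.
by move=> x /sub[/phiO|/psiO].
Qed.

Lemma test_function_partial i phi : test_function phi ->
  test_function (partial i phi).
Proof.
move=> tphi; have [sphi _ _] := tphi.
apply: (test_function_supp tphi); first exact: smooth_partial.
move=> x /=; apply: contra_neqP => xK.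
(* The complement of the support is open, so near [x] the function is constant and its derivative
   vanishes. *)
have xnear : \forall y \near x, phi y = 0.
  have := open_nbhs_nbhs (conj (closed_openC (@closed_closure _ _)) xK).
  apply: filterS => y yK; apply/eqP/negPn/negP => yN0; apply: yK.
  exact: subset_closure.
by rewrite /partial (near_eq_derive _ xnear) derive_cst.
Qed.

Lemma test_function_coordM i phi : test_function phi ->
  test_function (fun x => x i 0 * phi x).
Proof.
move=> tphi; have [sphi _ _] := tphi.
apply: (test_function_supp tphi); first exact: smooth_coordM.
by move=> x /=; rewrite mulf_eq0 negb_or => /andP[_ ?]; exact: subset_closure.
Qed.

Lemma partial_coordM i phi (x : E) : test_function phi ->
  partial i (fun y => y i 0 * phi y) x = phi x + x i 0 * partial i phi x.
Proof.
move=> [sphi _ _]; rewrite /partial.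
have dx := is_derive_coordM i i x sphi.
by rewrite (@derive_val _ _ _ _ _ _ _ dx) eqxx mul1r addrC.
Qed.

Lemma test_function_bounded phi : test_function phi ->
  exists M, forall x, `|phi x| <= M.
Proof.
move=> [/smooth_continuous cphi cK _].
have : bounded_set (phi @` closure [set x | phi x != 0]).
  apply/compact_bounded/continuous_compact => //.
  exact: continuous_subspaceT.
(* Every real strictly above [M] is a bound on the support; [|M| + 1] is also nonnegative, hence a
   bound off the support, where [phi] is 0. *)
move=> [M [_ /(_ (`|M| + 1))]].
have /[swap]/[apply] : M < `|M| + 1 by rewrite (le_lt_trans (ler_norm _))// ltrDl.
move=> phiM; exists (`|M| + 1) => x.
have [->|px0] := eqVneq (phi x) 0; first by rewrite normr0 addr_ge0.
by apply: phiM; exists x => //; exact: subset_closure.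
Qed.

Lemma test_function_Lfun2 phi : test_function phi -> phi \in Lfun mu 2%:E.
Proof.
move=> tphi; have [M phiM] := test_function_bounded tphi.
have [/smooth_continuous/continuous_measurable_cV mphi _ _] := tphi.
apply: Lfun2P => //; apply: measurable_bounded_integrable => //.
- exact: cube_measure_fin.
- exact: measurable_funX.
- exists (M ^+ 2); split; first exact: num_real.
  move=> x Mx y _ /=; apply: le_trans (ltW Mx).
  by rewrite normrX ler_sqr ?nnegrE// (le_trans _ (phiM y)).
Qed.

End test_functions.

(** * The spaces [H^1] and [H^1_0], and the Poincare inequality *)

Section sobolev_theory.
Context {R : realType} {d : nat}.
Local Notation E := 'cV[R]_d.
Local Notation mu := (cube_measure R d).
Local Notation jet := (@jet R d).
Implicit Types (phi psi : E -> R) (u v w : jet) (i : 'I_d).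

Lemma ae_unit_cube : {ae mu, forall x, unit_cube R d x}.
Proof.
have mC := @measurable_unit_cube R d.
exists (~` unit_cube R d); split => //; first exact: measurableC.
by rewrite /cube_measure/= /mrestr setICl measure0.
Qed.

(** Isolates the integrability in [H1] from the weak-derivative identity, so that jets of test
    functions can be handled without integrating by parts. *)
Definition L2jet (u : jet) : Prop := u.1 \in Lfun mu 2%:E /\ L2field (grad u).

Lemma jetB_fun u v x : (u - v).1 x = u.1 x - v.1 x.
Proof. by []. Qed.

Lemma gradB u v x : grad (u - v) x = grad u x - grad v x.
Proof. by []. Qed.

Lemma gradB_coord u v x i : grad (u - v) x i 0 = grad u x i 0 - grad v x i 0.
Proof. by rewrite gradB !mxE. Qed.

Lemma L2jetB u v : L2jet u -> L2jet v -> L2jet (u - v).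
Proof.
move=> [Lu Lgu] [Lv Lgv]; split.
  have -> : (u - v).1 = (fun x => u.1 x - v.1 x) by [].
  by apply: LfunB Lu Lv; exact: lee1n.
move=> i; under eq_fun do rewrite gradB_coord.
by apply: LfunB (Lgu i) (Lgv i); exact: lee1n.
Qed.

Lemma H1_L2jet u : H1 R d u -> L2jet u.
Proof. by case. Qed.

Lemma L2jet_of phi : test_function phi -> L2jet (jet_of phi).
Proof.
move=> tphi; split; first exact: test_function_Lfun2.
move=> i; under eq_fun do rewrite /grad mxE.
exact/test_function_Lfun2/test_function_partial.
Qed.

Lemma H1B u v : H1 R d u -> H1 R d v -> H1 R d (u - v).
Proof.
move=> Hu Hv; have [Lw Lgw] := L2jetB (H1_L2jet Hu) (H1_L2jet Hv).
have [Lu Lgu Du] := Hu; have [Lv Lgv Dv] := Hv.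
split => // phi i tphi; have Lphi := test_function_Lfun2 tphi.
have Ldphi := test_function_Lfun2 (test_function_partial i tphi).
transitivity (L2ip u.1 (partial i phi) - L2ip v.1 (partial i phi)).
  rewrite /L2ip -Rint1B; [|exact: Lfun2_mul..].
  by congr Rintegral; apply/funext => x; rewrite jetB_fun mulrBl.
rewrite Du// Dv// -opprD; congr (- _).
rewrite /L2ip -Rint1B; [|exact: Lfun2_mul..].
by congr Rintegral; apply/funext => x; rewrite gradB_coord mulrBl.
Qed.

Lemma L2jet_sqr u : L2jet u ->
  (fun x => u.1 x ^+ 2 + dotv (grad u x) (grad u x)) \in Lfun mu 1.
Proof.
by move=> [Lu Lgu]; apply: LfunD; [|exact: Lfun2_sqr|exact: L2field_dotv].
Qed.

Lemma H1norm_sqr u : H1norm u ^+ 2 =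
  \int[mu]_x (u.1 x ^+ 2 + dotv (grad u x) (grad u x)).
Proof.
rewrite sqr_sqrtr//; apply: Rintegral_ge0 => x _.
by rewrite addr_ge0 ?sqr_ge0 ?dotv_ge0.
Qed.

(** Pointwise this is [|p + q|^2 >= 0] expanded; it stands in for the triangle inequality. *)
Lemma H1norm_sqrB u v : L2jet u -> L2jet v ->
  H1norm (u - v) ^+ 2 <= 2 * H1norm u ^+ 2 + 2 * H1norm v ^+ 2.
Proof.
move=> Lu Lv; have Lw := L2jetB Lu Lv.
rewrite !H1norm_sqr -!Rint1Z; [|exact: L2jet_sqr..].
rewrite -Rint1D; [|by apply: LfunZ => //; exact: L2jet_sqr..].
apply: ae_le_Rint1; first exact: L2jet_sqr.
  by apply: LfunD => //; apply: LfunZ => //; exact: L2jet_sqr.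
apply: aeW => x; rewrite jetB_fun gradB.
move: (u.1 x) (v.1 x) (grad u x) (grad v x) => a b g h.
have := dotv_ge0 (g + h); have := sqr_ge0 (a + b).
rewrite !dotvBl !dotvBr dotvDl ![dotv _ (g + h)]dotvC !dotvDl (dotvC h g).
nra.
Qed.

Lemma jet_ofB phi psi : test_function phi -> test_function psi ->
  jet_of (fun x => phi x - psi x) = jet_of phi - jet_of psi.
Proof.
move=> [sphi _ _] [spsi _ _]; congr pair; apply/funext => x.
apply/colP => i.
have -> : ((fun y => \col_j partial j phi y) - (fun y => \col_j partial j psi y)) x
  = \col_j partial j phi x - \col_j partial j psi x by [].
by rewrite !mxE partialB//; exact: smooth_derivable.
Qed.

Lemma H10B u v : H10 R d u -> H10 R d v -> H10 R d (u - v).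
Proof.
(* Precision [e / 2] for each term is enough, since [2 (e/2)^2 + 2 (e/2)^2 = e^2]. *)
move=> [Hu Au] [Hv Av]; split; first exact: H1B.
move=> e e0; have e20 : 0 < e / 2 by rewrite divr_gt0.
have half (a b : R) : a < (e / 2) ^+ 2 -> b < (e / 2) ^+ 2 ->
  2 * a + 2 * b < e ^+ 2 by lra.
have [phi tphi uphi] := Au _ e20; have [psi tpsi vpsi] := Av _ e20.
exists (fun x => phi x - psi x); first exact: test_functionB.
rewrite jet_ofB//.
have -> : u - v - (jet_of phi - jet_of psi) =
    (u - jet_of phi) - (v - jet_of psi).
  by rewrite !opprB addrACA [RHS]addrACA; congr (_ + _); rewrite addrC.
have sq w : H1norm w < e / 2 -> H1norm w ^+ 2 < (e / 2) ^+ 2.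
  by move=> we; rewrite ltr_sqr ?nnegrE ?sqrtr_ge0// ltW.
rewrite -ltr_sqr ?nnegrE ?sqrtr_ge0//; last exact: ltW.
have Luphi := L2jetB (H1_L2jet Hu) (L2jet_of tphi).
have Lvpsi := L2jetB (H1_L2jet Hv) (L2jet_of tpsi).
exact: le_lt_trans (H1norm_sqrB Luphi Lvpsi) (half _ _ (sq _ uphi) (sq _ vpsi)).
Qed.

(* [a], [g] are values of [u] and its [i]-th derivative, [v], [w] those of the
   error [u - phi], and [x] is the [i]-th coordinate. *)
Let poincare_integrand (t s x a g v w : R) : 0 < t -> t * s = 1 -> 0 < x < 1 ->
  (2^-1 - t) * a ^+ 2 - (2 + t) * g ^+ 2 - s * (v ^+ 2 + w ^+ 2) <=
  a * (a - v + x * (g - w)) + g * (x * (a - v)).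
Proof.
move=> t0 ts x01; have s0 : 0 < s by rewrite -(pmulr_rgt0 _ t0) ts.
have x2 : x ^+ 2 <= 1 by nra.
(* Weighted AM-GM: the weight [t], later small, falls on [a] and [g], and [s = 1/t] on the error
   terms. *)
have amgm (b c : R) : 2 * (b * c) <= t * b ^+ 2 + s * c ^+ 2.
  have := mulr_ge0 (ltW t0) (sqr_ge0 (b - s * c)).
  have -> : t * (b - s * c) ^+ 2 =
    t * b ^+ 2 - 2 * (t * s) * (b * c) + (t * s) * s * c ^+ 2 by ring.
  by rewrite ts; lra.
have shrink (b : R) : (x * b) ^+ 2 <= b ^+ 2.
  by rewrite exprMn ler_piMl ?sqr_ge0.
have := amgm a v; have := amgm a (x * w); have := amgm g (x * v).
have := ler_wpM2l (ltW s0) (shrink w); have := ler_wpM2l (ltW s0) (shrink v).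
(* Half of this square gives [2 x a g >= - a^2 / 2 - 2 (x g)^2], the source of the constants [2^-1]
   and [2]. *)
have := shrink g; have := sqr_ge0 (a + 2 * (x * g)).
have := mulr_ge0 (ltW s0) (sqr_ge0 w).
have := mulr_ge0 (ltW t0) (sqr_ge0 g).
nra.
Qed.

(* Testing the weak derivative of u against x_i phi, with phi a test function
   close to u, gives int u^2 = - 2 int x_i u D_i u in the limit. *)
Lemma poincare u i : H10 R d u ->
  \int[mu]_x (u.1 x ^+ 2) <= 4 * \int[mu]_x (grad u x i 0 ^+ 2).
Proof.
move=> [Hu Au]; have [Lu Lgu Du] := Hu.
set a := \int[mu]_x (u.1 x ^+ 2); set b := \int[mu]_x (grad u x i 0 ^+ 2).
have a0 : 0 <= a by apply: Rintegral_ge0 => x _; exact: sqr_ge0.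
have b0 : 0 <= b by apply: Rintegral_ge0 => x _; exact: sqr_ge0.
have combine (t p q c : R) : (2^-1 - t) * p - (2 + t) * q - c <= 0 -> c <= t ->
  2^-1 * p - 2 * q <= t * (p + q + 1) by lra.
(* With [phi] within [t] of [u], the error term is at most [t^-1 t^2 = t], so everything on the
   right is of order [t]. *)
have key t : 0 < t -> 2^-1 * a - 2 * b <= t * (a + b + 1).
  move=> t0; have [phi tphi uphi] := Au _ t0.
  have ts : t * t^-1 = 1 by rewrite mulfV// gt_eqF.
  have Lv := L2jetB (H1_L2jet Hu) (L2jet_of tphi).
  have txphi := test_function_coordM i tphi.
  have Lxphi := test_function_Lfun2 txphi.
  have Ldxphi := test_function_Lfun2 (test_function_partial i txphi).
  have nphi : H1norm (u - jet_of phi) ^+ 2 <= t ^+ 2.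
    by rewrite ler_sqr ?nnegrE ?sqrtr_ge0// ltW.
  have I0 : \int[mu]_x (u.1 x * partial i (fun y => y i 0 * phi y) x +
      grad u x i 0 * (x i 0 * phi x)) = 0.
    rewrite Rint1D; [|exact: Lfun2_mul..].
    by rewrite [X in X + _](Du _ i txphi) addNr.
  have La : (fun x => (2^-1 - t) * u.1 x ^+ 2) \in Lfun mu 1.
    by apply: LfunZ => //; exact: Lfun2_sqr.
  have Lb : (fun x => (2 + t) * grad u x i 0 ^+ 2) \in Lfun mu 1.
    by apply: LfunZ => //; exact: Lfun2_sqr.
  have Lab : (fun x => (2^-1 - t) * u.1 x ^+ 2 - (2 + t) * grad u x i 0 ^+ 2)
    \in Lfun mu 1 by exact: LfunB.
  set v := u - jet_of phi.
  have Lvt : (fun x => t^-1 * (v.1 x ^+ 2 + dotv (grad v x) (grad v x)))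
    \in Lfun mu 1 by apply: LfunZ => //; exact: L2jet_sqr.
  have : \int[mu]_x ((2^-1 - t) * u.1 x ^+ 2 - (2 + t) * grad u x i 0 ^+ 2
      - t^-1 * (v.1 x ^+ 2 + dotv (grad v x) (grad v x))) <= 0.
    rewrite -I0; apply: ae_le_Rint1; first exact: LfunB.
      by apply: LfunD => //; exact: Lfun2_mul.
    apply: filterS ae_unit_cube => x /(_ i) x01.
    have vE : phi x = u.1 x - v.1 x by rewrite jetB_fun subKr.
    have wE : partial i phi x = grad u x i 0 - grad v x i 0.
      by rewrite gradB_coord subKr mxE.
    rewrite partial_coordM// vE wE.
    apply: le_trans (poincare_integrand _ _ _ _ t0 ts x01).
    rewrite lerB// ler_wpM2l ?invr_ge0 ?(ltW t0)// lerD2l.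
    exact: sqr_coord_le_dotv.
  rewrite Rint1B// Rint1B// !Rint1Z;
    [|exact: L2jet_sqr|exact: Lfun2_sqr|exact: Lfun2_sqr].
  rewrite -H1norm_sqr -/a -/b.
  have : t^-1 * H1norm v ^+ 2 <= t.
    by rewrite ler_pdivrMl// -expr2.
  by move=> ct /combine; exact.
clearbody a b; rewrite leNgt; apply/negP => ba.
(* If [2^-1 a - 2 b] were positive, the [t] chosen below would make the right side of [key] half of
   it. *)
have c0 : 0 < 2 * (a + b + 1) by lra.
have t0 : 0 < (2^-1 * a - 2 * b) / (2 * (a + b + 1)) by rewrite divr_gt0//; lra.
have := key _ t0.
have -> : (2^-1 * a - 2 * b) / (2 * (a + b + 1)) * (a + b + 1) =
  (2^-1 * a - 2 * b) / 2 by field; lra.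
lra.
Qed.

(** Poincare in one direction, available as [0 < d], bounds the function with constant 4; the
    gradient itself adds 1. *)
Lemma H1norm_le_grad u : (0 < d)%N -> H10 R d u ->
  H1norm u ^+ 2 <= 5 * \int[mu]_x dotv (grad u x) (grad u x).
Proof.
move=> d0 Hu; have i : 'I_d := Ordinal d0.
have [Lu Lgu] := H1_L2jet Hu.1; have Lg := L2field_dotv Lgu Lgu.
rewrite H1norm_sqr Rint1D//; last exact: Lfun2_sqr.
have := poincare i Hu.
have : \int[mu]_x (grad u x i 0 ^+ 2) <= \int[mu]_x dotv (grad u x) (grad u x).
  apply: ae_le_Rint1 => //; first exact: Lfun2_sqr.
  by apply: aeW => x; exact: sqr_coord_le_dotv.
lra.
Qed.

End sobolev_theory.

(** * Geometric decay of the error in energy and convergence in [H^1] *)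

Theorem theorem2p1 (R : realType) (d : nat) (hd : (1 <= d <= 3)%N)
  (f : 'cV[R]_d -> R) (hf : f \in Lfun (cube_measure R d) 2%:E)
  (Aeps A0 : 'cV[R]_d -> 'M[R]_d)
  (hAeps : Linfty_sym Aeps) (hA0 : Linfty_sym A0)
  (lm_eps lp_eps lm_0 lp_0 : R)
  (hlm_eps : 0 < lm_eps) (hlp_eps : 0 < lp_eps)
  (hlm_0 : 0 < lm_0) (hlp_0 : 0 < lp_0)
  (ell_eps : {ae cube_measure R d, forall x, forall z : 'cV[R]_d,
    lm_eps * dotv z z <= dotv (Aeps x *m z) z <= lp_eps * dotv z z})
  (ell_0 : {ae cube_measure R d, forall x, forall z : 'cV[R]_d,
    lm_0 * dotv z z <= dotv (A0 x *m z) z <= lp_0 * dotv z z})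
  (lambda1 cplus : R) (hlambda1 : 0 < lambda1) (hcplus : 0 < cplus)
  (hlow : {ae cube_measure R d, forall x, forall z : 'cV[R]_d,
    lambda1 * dotv (A0 x *m z) z <= dotv (Aeps x *m z) z})
  (hup : {ae cube_measure R d, forall x, forall z : 'cV[R]_d,
    dotv (Aeps x *m invmx (A0 x) *m Aeps x *m z) z
      <= cplus * dotv (A0 x *m z) z})
  (ueps : jet) (hueps : H10 R d ueps)
  (sol : forall w, H10 R d w -> aform Aeps ueps w = L2ip f w.1)
  (u0 : jet) (hu0 : H10 R d u0)
  (rho : R) (hrho : 0 < rho < 2 * (lambda1 / cplus))
  (u : nat -> jet) (hu : forall k, H10 R d (u k)) (u_init : u 0%N = u0)
  (u_rec : forall k w, H10 R d w ->
    aform A0 (u k.+1) w =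
      aform A0 (u k) w - rho * (aform Aeps (u k) w - L2ip f w.1)) :
  let q := Num.sqrt (1 - 2 * rho * lambda1 + rho ^+ 2 * cplus) in
  (H1norm (u k - ueps) @[k --> \oo] --> (0 : R)) /\
  (forall k, energy_norm A0 (u k - ueps)
    <= q ^+ k * energy_norm A0 (u0 - ueps)).
Proof.
have half (a b : R) : a <= 2^-1 * b + 2^-1 * a -> a <= b by lra.
move=> q; have d0 : (0 < d)%N by case/andP: hd.
have [rho0 rho2] := andP hrho.
pose e k := u k - ueps; have He k : H10 R d (e k) := H10B (hu k) hueps.
have Lu k : L2field (grad (u k)) := H1_L2field (hu k).1.
have Lueps : L2field (grad ueps) := H1_L2field hueps.1.
have Le k : L2field (grad (e k)) := H1_L2field (He k).1.
have A0form_ge0 k : 0 <= aform A0 (e k) (e k).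
  pose z (x : 'cV[R]_d) : R := 0.
  have -> : 0 = \int[cube_measure R d]_x z x.
    by rewrite /Rintegral integral0.
  have Lz : z \in Lfun (cube_measure R d) 1.
    by apply/Lfun1_integrable; exact: integrable0.
  apply: ae_le_Rint1 => //; first exact: L2field_form.
  apply: filterS ell_0 => x ell0x; have /andP[+ _] := ell0x (grad (e k) x).
  by apply: le_trans; rewrite mulr_ge0 ?dotv_ge0// ltW.
(* [Num.sqrt] is 0 on negative reals, so both signs of the radicand yield the inequality that
   [richardson_step_le] asks for. *)
have qle : 1 - 2 * rho * lambda1 + rho ^+ 2 * cplus <= q ^+ 2.
  rewrite /q; set D := (X in Num.sqrt X); have [D0|D0] := leP 0 D.
    by rewrite sqr_sqrtr.
  by rewrite (le_trans (ltW D0))// sqr_ge0.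
have q0 : 0 <= q by exact: sqrtr_ge0.
have q1 : q < 1.
  rewrite -sqrtr1 /q ltr_sqrt//.
  (* The radicand minus 1 is [rho (rho cplus - 2 lambda1)], negative by the upper bound on [rho]. *)
  have : rho * cplus < 2 * lambda1 by rewrite -ltr_pdivlMr// -mulrA.
  by rewrite -(ltr_pM2l rho0); lra.
have err k w : H10 R d w ->
    aform A0 (e k.+1) w = aform A0 (e k) w - rho * aform Aeps (e k) w.
  move=> Hw; have Lw := H1_L2field Hw.1.
  by rewrite !aformBl// u_rec// sol//; ring.
have step k : aform A0 (e k.+1) (e k.+1) <= q ^+ 2 * aform A0 (e k) (e k).
  have : aform A0 (e k) (e k.+1) - rho * aform Aeps (e k) (e k.+1) <=
      2^-1 * (q ^+ 2 * aform A0 (e k) (e k)) + 2^-1 * aform A0 (e k.+1) (e k.+1).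
    have LA i j := L2field_form hA0 (Le i) (Le j).
    have LB i j := L2field_form hAeps (Le i) (Le j).
    rewrite /aform -!Rint1Z; [|by try (apply: LfunZ => //)..].
    rewrite -Rint1B//; last exact: LfunZ.
    rewrite -Rint1D; [|by do 2 ?apply: LfunZ => //..].
    apply: ae_le_Rint1; first by apply: LfunB => //; exact: LfunZ.
      by apply: LfunD => //; do 2 ?apply: LfunZ => //.
    near=> x.
    apply: (@richardson_step_le _ _ _ _ lm_0 lambda1 cplus) => //.
    - by near: x; exact: hA0.2.
    - by near: x; exact: hAeps.2.
    - move=> z; suff /(_ z)/andP[] : forall z, lm_0 * dotv z z <=
        dotv (A0 x *m z) z <= lp_0 * dotv z z by [].
      by near: x.
    - by near: x; apply: filterS hlow => x; exact.
    - by near: x; apply: filterS hup => x; exact.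
    - exact: ltW.
  (* By [err] the left side is the new squared energy, so the half of it on the right is
     absorbed. *)
  by move: (err k _ (He k.+1)) => <-; exact: half.
have energy k : energy_norm A0 (e k) <= q ^+ k * energy_norm A0 (u0 - ueps).
  elim: k => [|k IH]; first by rewrite expr0 mul1r /e u_init.
  rewrite exprS -mulrA; apply: le_trans (ler_wpM2l q0 IH).
  rewrite /energy_norm -[X in X * _](ger0_norm q0) -sqrtr_sqr.
  by rewrite -sqrtrM ?sqr_ge0// ler_wsqrtr.
split => //.
(* The factor 5 is from [H1norm_le_grad], and [1 / lm_0] from the lower ellipticity bound of
   [A0]. *)
have H1_energy k :
    H1norm (e k) <= Num.sqrt (5 / lm_0) * energy_norm A0 (e k).
  have c0 : 0 <= 5 / lm_0 by rewrite divr_ge0// ltW.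
  rewrite -sqrtrM// -[leLHS]ger0_norm ?sqrtr_ge0// -sqrtr_sqr ler_wsqrtr//.
  apply: le_trans (H1norm_le_grad d0 (He k)) _.
  rewrite -mulrA ler_wpM2l// ler_pdivlMl// -Rint1Z; last exact: L2field_dotv.
  apply: ae_le_Rint1; [by apply: LfunZ => //; exact: L2field_dotv
    |exact: L2field_form|].
  by apply: filterS ell_0 => x /(_ (grad (e k) x))/andP[].
pose C := Num.sqrt (5 / lm_0) * energy_norm A0 (u0 - ueps).
apply: (@squeeze_cvgr _ _ _ _ (fun=> 0) (fun k => C * q ^+ k)).
- apply: nearW => k; rewrite sqrtr_ge0/=; apply: le_trans (H1_energy k) _.
  by rewrite /C -mulrA ler_wpM2l ?sqrtr_ge0// mulrC; exact: energy.
- exact: cvg_cst.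
- rewrite -[X in _ --> X](mulr0 C); apply: cvgMr.
  by apply: cvg_expr; rewrite ger0_norm.
Unshelve. all: by end_near. Qed.
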